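(* Let $G$ be a graph and let $r$ be an integer with $0<r\le\lfloor e(G)/2\rfloor$. Then $G$ is $r$-tonal if and only if $G$ has both a partition $V(G)=X\cup Y$ and a set of vertices $W\subseteq V(G)$ such that $e(X,Y),\, e(G[W])\in\{r,\,e(G)-r\}$.
   Context: Graphs are finite and simple; $e(G)=|E(G)|$; for a partition $V(G)=X\cup Y$ (disjoint parts, possibly empty), $e(X,Y)$ is the number of edges with one end in $X$ and the other in $Y$; $G[W]$ is the subgraph induced by $W$. A $2$-coloring $E(K_n)=E(R)\cup E(B)$ is a partition of the edges of $K_n$ into red edges (forming $R$) and blue edges (forming $B$). An $(r,b)$-colored copy of $G$ (with $r+b=e(G)$) is a (not necessarily induced) subgraph of $K_n$ isomorphic to $G$ with exactly $r$ red and $b$ blue edges. For an integer $r$ with $0<r\le\lfloor e(G)/2\rfloor$, ${\rm bal}_r(n,G)$ is the minimum non-negative integer $s$ such that every $2$-coloring $E(K_n)=E(R)\cup E(B)$ with $\min\{e(R),e(B)\}>s$ contains an $(r,e(G)-r)$-colored copy of $G$ or an $(e(G)-r,r)$-colored copy of $G$. The graph $G$ is $r$-tonal if for every sufficiently large $n$ such an integer exists non-vacuously, that is, ${\rm bal}_r(n,G)<\lfloor\frac12\binom n2\rfloor$ (so that there are colorings with $\min\{e(R),e(B)\}>{\rm bal}_r(n,G)$). *)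

(* Defs.v *)
From mathcomp Require Import all_boot.

Set Implicit Arguments.
Unset Strict Implicit.
Unset Printing Implicit Defensive.

Record sgraph := SGraph {
  vertex :> finType;
  adj : rel vertex;
  adj_sym : symmetric adj;
  adj_irr : irreflexive adj }.

(* Edges are unordered pairs, so that cardinals of edge sets count each edge
   once. *)
Definition edges (G : sgraph) : {set {set G}} :=
  [set [set p.1; p.2] | p : G * G & adj p.1 p.2].

Definition num_edges (G : sgraph) : nat := #|edges G|.

Definition num_cross_edges (G : sgraph) (X Y : {set G}) : nat :=
  #|[set a in edges G | [exists x in X, exists y in Y, a == [set x; y]]]|.

Section Induced.
Variables (G : sgraph) (W : {set G}).

Definition induced_adj : rel {x : G | x \in W} :=
  fun x y => adj (val x) (val y).

Lemma induced_adj_sym : symmetric induced_adj.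
Proof. by move=> x y; rewrite /induced_adj adj_sym. Qed.

Lemma induced_adj_irr : irreflexive induced_adj.
Proof. by move=> x; rewrite /induced_adj adj_irr. Qed.

Definition induced : sgraph := SGraph induced_adj_sym induced_adj_irr.

End Induced.

Section Complete.
Variable n : nat.

Definition complete_adj : rel 'I_n := fun i j => i != j.

Lemma complete_adj_sym : symmetric complete_adj.
Proof. by move=> i j; rewrite /complete_adj eq_sym. Qed.

Lemma complete_adj_irr : irreflexive complete_adj.
Proof. by move=> i; rewrite /complete_adj eqxx. Qed.

Definition complete : sgraph := SGraph complete_adj_sym complete_adj_irr.

End Complete.

Section Balance.
Variables (n : nat) (G : sgraph).
Implicit Types (R B F : {set {set complete n}}).

Definition two_coloring R B : bool :=
  (R :|: B == edges (complete n)) && [disjoint R & B].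

(* The subgraphs of K_n isomorphic to G are the images of G under injective
   vertex maps; F is the edge set of such an image. Any injection works, since
   all pairs of distinct vertices are edges of K_n. *)
Definition copy_edges F : bool :=
  [exists f : {ffun G -> complete n},
     injectiveb f && (F == [set f @: (a : {set G}) | a in edges G])].

Definition has_colored_copy R B (r b : nat) : bool :=
  [exists F, [&& copy_edges F, #|F :&: R| == r & #|F :&: B| == b]].

Definition forces_balance (r s : nat) : bool :=
  [forall R, forall B,
     two_coloring R B && (s < minn #|R| #|B|) ==>
     (has_colored_copy R B r (num_edges G - r)
      || has_colored_copy R B (num_edges G - r) r)].

(* Large s satisfy the condition vacuously, so the minimum always exists. *)
Lemma forces_balance_ex (r : nat) : exists s, forces_balance r s.
Proof.
exists (num_edges (complete n)); apply/forallP=> R; apply/forallP=> B.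
apply/implyP=> /andP[/andP[/eqP RB _]]; rewrite leq_min => /andP[].
by rewrite /num_edges -RB ltnNge subset_leq_card ?subsetUl.
Qed.

Definition bal (r : nat) : nat := ex_minn (forces_balance_ex r).

End Balance.

Definition tonal (r : nat) (G : sgraph) : Prop :=
  exists N, forall n, N <= n -> bal n G r < 'C(n, 2)./2.

(* Main.v *)
(** Since bal_r(n, G) is a minimum, G is r-tonal iff for all large n the
    colorings of K_n whose color classes both have at least
    floor(binom(n, 2) / 2) edges contain a suitable copy of G.

    Necessity: for infinitely many n some clique of K_n has exactly half of the
    edges (a Pell equation), and for every square n so does some complete
    bipartite spanning subgraph. A suitable copy of G in these colorings gives
    W and (X, Y) respectively, as preimages of the clique and of the parts.

    Sufficiency: for large n such a coloring contains disjoint A and B of size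
    |V(G)| and a color c such that, on the union of A and B, the edges of color
    c are either exactly those inside A or exactly those between A and B.
    Sending W, respectively X, to A and the rest to B gives the copy. *)

Require Import Defs.
From mathcomp Require Import all_boot.
From mathcomp Require Import zify.

Set Implicit Arguments.
Unset Strict Implicit.
Unset Printing Implicit Defensive.

(** * Unavoidable patterns in two-colored complete graphs *)

Section Patterns.
Variable T : finType.
Implicit Types (e : rel T) (A B P S U : {set T}).

Definition monochromatic e (c : bool) A :=
  {in A &, forall x y, x != y -> e x y = c}.

Definition monochromatic_between e (c : bool) A B :=
  {in A & B, forall x y, e x y = c}.

Lemma monochromatic_setU1 e c v A :
  symmetric e -> monochromatic e c A -> {in A, forall x, e v x = c} ->
  monochromatic e c (v |: A).
Proof.
move=> sym mA vA x y; rewrite !inE => /predU1P[->|xA] /predU1P[->|yA].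
- by rewrite eqxx.
- by move=> _; apply: vA.
- by move=> _; rewrite sym; apply: vA.
- exact: mA.
Qed.

Lemma exists_subset_card A k :
  k <= #|A| -> exists2 S : {set T}, S \subset A & #|S| = k.
Proof.
move=> kA; have : 0 < #|[set S : {set T} | S \subset A & #|S| == k]|.
  by rewrite cards_draws bin_gt0.
by case/card_gt0P=> S /[!inE] /andP[SA /eqP Sk]; exists S.
Qed.

(** Pigeonhole: elements of [U] are sorted by their trace on [P], and only [2 ^ #|P|] traces
    exist. *)
Lemma common_trace e P U t :
  2 ^ #|P| * t <= #|U| ->
  exists2 S : {set T}, S \subset P &
    t <= #|[set y in U | [set x in P | e x y] == S]|.
Proof.
move=> PU; apply/exists_inP; apply: contraT; rewrite negb_exists_in.
move=> /forall_inP small.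
have t_gt0 : 0 < t.
  have := small set0 (sub0set P); rewrite -ltnNge; exact: leq_ltn_trans.
suff : #|U| <= 2 ^ #|P| * t.-1.
  by move=> /(leq_trans PU); rewrite leq_pmul2l ?expn_gt0 //; lia.
rewrite -sum1_card.
rewrite (partition_big (fun y => [set x in P | e x y]) (mem (powerset P))) /=.
  rewrite -card_powerset -sum_nat_const; apply: leq_sum => S SP.
  rewrite inE in SP; rewrite -ltnS prednK //.
  move: (small S SP); rewrite -ltnNge -sum1_card; apply: leq_ltn_trans.
  by rewrite leq_eqVlt; apply/orP; left; apply/eqP/eq_bigl => y; rewrite !inE.
by move=> y _; rewrite inE; apply/subsetP=> x; rewrite inE => /andP[].
Qed.

End Patterns.

(** The classical recursion: the color of the edge to a fixed vertex [v] splits the other vertices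
    of [S] in two, and in a large enough class a clique either is already as required or becomes so
    by adding [v]. *)
Lemma ramsey a b : exists N, forall (T : finType) (e : rel T) c (S : {set T}),
  symmetric e -> N <= #|S| ->
  (exists A : {set T}, [/\ A \subset S, #|A| = a & monochromatic e c A]) \/
  (exists A : {set T}, [/\ A \subset S, #|A| = b & monochromatic e (~~ c) A]).
Proof.
have mono0 T e c : @monochromatic T e c set0 by move=> x y; rewrite inE.
elim: a b => [|a IHa] b.
  by exists 0 => T e c S _ _; left; exists set0; rewrite sub0set cards0.
elim: b => [|b [N2 IHb]].
  by exists 0 => T e c S _ _; right; exists set0; rewrite sub0set cards0.
have [N1 {}IHa] := IHa b.+1; exists (N1 + N2).+1 => T e c S sym NS.
have [v vS] : exists v, v \in S by apply/card_gt0P; apply: leq_trans NS.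
pose S1 := [set x in S :\ v | e v x == c].
pose S2 := [set x in S :\ v | e v x == ~~ c].
have S12 : N1 + N2 <= #|S1| + #|S2|.
  have -> : S2 = S :\ v :\: S1.
    by apply/setP=> x; rewrite !inE; case: (x == v); case: (x \in S);
       case: (e v x); case: (c).
  have := cardsID S1 (S :\ v); rewrite (setIidPr _); last first.
    by apply/subsetP=> x; rewrite inE => /andP[].
  by move=> ->; move: (cardsD1 v S); rewrite vS; lia.
have subS (c' : bool) (A : {set T}) k : A \subset [set x in S :\ v | e v x == c'] ->
    #|A| = k -> monochromatic e c' A ->
    [/\ v |: A \subset S, #|v |: A| = k.+1 & monochromatic e c' (v |: A)].
  move=> /subsetP sA kA mA.
  have inA x : x \in A -> [/\ x != v, x \in S & e v x = c'].
    by move=> /sA; rewrite !inE => /andP[/andP[-> ->] /eqP].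
  split.
  - by rewrite subUset sub1set vS; apply/subsetP=> x /inA[].
  - rewrite cardsU1 kA; case: (boolP (v \in A)) => // /inA[].
    by rewrite eqxx.
  - by apply: monochromatic_setU1 => // x /inA[].
have SvS (c' : bool) (A : {set T}) : A \subset [set x in S :\ v | e v x == c'] -> A \subset S.
  move=> sA; apply: subset_trans sA _; apply/subsetP=> x.
  by rewrite !inE => /andP[/andP[]].
case: (leqP N1 #|S1|) => [N1S|S1N].
  have [[A [sA kA mA]]|[A [sA kA mA]]] := IHa T e c S1 sym N1S.
    by left; exists (v |: A); apply: subS.
  by right; exists A; split=> //; apply: SvS sA.
have N2S : N2 <= #|S2| by lia.
have [[A [sA kA mA]]|[A [sA kA mA]]] := IHb T e c S2 sym N2S.
  by left; exists A; split=> //; apply: SvS sA.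
by right; exists (v |: A); apply: subS.
Qed.

(** Take [2 * t] vertices [P] of [A] and [t] vertices of [B] with the same trace on [P]; that trace
    or its complement in [P] has at least [t] elements. *)
Lemma bipartite_ramsey t : exists k, forall (T : finType) (e : rel T) (A B : {set T}),
  k <= #|A| -> k <= #|B| ->
  exists c (A' B' : {set T}), [/\ A' \subset A, B' \subset B, #|A'| = t, #|B'| = t
                    & monochromatic_between e c A' B'].
Proof.
exists (2 * t + 2 ^ (2 * t) * t) => T e A B kA kB.
have [P PA Pt] : exists2 P : {set T}, P \subset A & #|P| = 2 * t.
  by apply: exists_subset_card; lia.
have [S SP] : exists2 S : {set T}, S \subset P &
    t <= #|[set y in B | [set x in P | e x y] == S]|.
  by apply: common_trace; rewrite Pt; lia.
move=> /exists_subset_card[B' sB' B't].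
have inB' y : y \in B' -> y \in B /\ [set x in P | e x y] = S.
  by move/(subsetP sB'); rewrite inE => /andP[? /eqP].
have B'B : B' \subset B by apply/subsetP=> y /inB'[].
pose D (c : bool) := if c then S else P :\: S.
have [c tD] : exists c, t <= #|D c|.
  have := cardsID S P; rewrite (setIidPr SP) Pt => SD.
  by case: (leqP t #|S|) => ?; [exists true | exists false; rewrite /D /=; lia].
have [A' sA' A't] := exists_subset_card tD.
have DP : D c \subset P by case: (c) => //=; apply: subsetDl.
exists c, A', B'; split=> //; first exact: subset_trans (subset_trans sA' DP) PA.
move=> x y /(subsetP sA') xD /inB'[_ SE].
have xP := subsetP DP x xD.
by case: (c) xD; rewrite /= -SE !inE xP //=; case: (e x y).
Qed.

(* Qualitative Kovari-Sos-Turan, without convexity: 16q vertices of linear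
   degree already send q edges to a linear number of vertices, and only
   2 ^ (16 q) traces on those 16q vertices are available. *)
Lemma dense_complete_bipartite q : exists n0, forall (T : finType) (f : rel T),
  n0 <= #|T| -> #|T| ^ 2 <= 8 * #|[set p : T * T | f p.1 p.2]| ->
  exists S U : {set T}, [/\ q <= #|S|, q <= #|U| & {in S & U, forall x y, f x y}].
Proof.
case: q => [|q].
  by exists 0 => T f _ _; exists set0, set0; split=> // x y; rewrite inE.
set Q := q.+1; pose p := 16 * Q.
(* The first summand forces [p] elements in [H], the second [2 ^ p * Q] elements in [Good]. *)
exists (16 * p + p * (2 ^ p * Q)) => T f; set n := #|T| => n0n dense.
have n_gt0 : 0 < n by move: n0n; rewrite /p /Q; lia.
pose d u := #|[set v | f u v]|.
have pairsE : #|[set p : T * T | f p.1 p.2]| = \sum_u d u.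
  under eq_bigr => u _ do rewrite /d -sum1_card.
  rewrite pair_big_dep /= -sum1_card; apply: eq_bigl => -[u v].
  by rewrite !inE.
(* The average degree is at least [n / 8]; vertices outside [H] contribute at most [n / 16] each, so
   [n <= 16 * #|H|]. *)
pose H := [set u | n <= 16 * d u].
have sumH : 16 * \sum_u d u <= 16 * (#|H| * n) + n ^ 2.
  have -> : #|H| * n = \sum_u (u \in H) * n.
    by rewrite -big_distrl -sum1_card /= big_mkcond.
  have -> : n ^ 2 = \sum_(u : T) n by rewrite sum_nat_const.
  rewrite !big_distrr -big_split /=; apply: leq_sum => u _.
  have : d u <= n by apply: max_card.
  by rewrite inE; case: leqP => /=; lia.
have [P PH Pp] : exists2 P : {set T}, P \subset H & #|P| = p.
  apply: exists_subset_card.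
  by move: sumH dense n0n n_gt0; rewrite pairsE; nia.
pose tr v := #|[set u in P | f u v]|.
have trE : \sum_(u in P) d u = \sum_v tr v.
  under eq_bigr => u _ do rewrite /d -sum1_card big_mkcond.
  rewrite exchange_big; apply: eq_bigr => v _; rewrite /tr -sum1_card.
  rewrite big_mkcond [RHS]big_mkcond; apply: eq_bigr => u _.
  by rewrite !inE; case: (u \in P).
have Qn : Q * n <= \sum_v tr v.
  rewrite -trE -(leq_pmul2l (isT : 0 < 16)) mulnA -[16 * Q]Pp -sum_nat_const.
  rewrite big_distrr; apply: leq_sum => u /(subsetP PH).
  by rewrite inE.
(* The traces have total size at least [Q * n]. Vertices outside [Good] account for at most
   [q = Q - 1] each, so the remaining [n] must come from [Good], at most [p] per vertex. *)
pose Good := [set v | Q <= tr v].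
have nGood : n <= p * #|Good|.
  suff : \sum_v tr v <= q * n + p * #|Good| by move=> /(leq_trans Qn); rewrite mulSn addnC leq_add2l.
  have -> : q * n = \sum_(v : T) q by rewrite sum_nat_const mulnC.
  have -> : #|Good| = \sum_v (v \in Good) by rewrite -sum1_card big_mkcond.
  rewrite big_distrr -big_split /=; apply: leq_sum => v _.
  have : tr v <= p by rewrite -Pp; apply/subset_leq_card/subsetP=> x; rewrite inE => /andP[].
  by rewrite inE /Q; case: ltnP => /=; lia.
have [S SP QS] : exists2 S : {set T}, S \subset P &
    Q <= #|[set y in Good | [set x in P | f x y] == S]|.
  by apply: common_trace; rewrite Pp; move: nGood n0n; rewrite /p /Q; nia.
exists S, [set y in Good | [set x in P | f x y] == S]; split=> //.
  have /card_gt0P[y] := leq_trans (isT : 0 < Q) QS.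
  by rewrite !inE => /andP[gy /eqP <-].
by move=> x y xS; rewrite inE => /andP[_ /eqP SE]; rewrite -SE inE in xS; case/andP: xS.
Qed.

(* Cliques of both colors, joined by a monochromatic bipartite graph inside
   them, give the split pattern; if color [~~ c] has no large clique, then each
   side of a complete bipartite graph of that color contains a large clique of
   color [c]. *)
Lemma unavoidable_pattern t : exists n0, forall (T : finType) (e : rel T),
  symmetric e -> n0 <= #|T| ->
  (forall c, #|T| ^ 2 <= 8 * #|[set p : T * T | (p.1 != p.2) && (e p.1 p.2 == c)]|) ->
  exists c (A B : {set T}),
    [/\ [disjoint A & B], #|A| = t, #|B| = t, monochromatic e (~~ c) B
      & monochromatic e c A /\ monochromatic_between e (~~ c) A B \/
        monochromatic e (~~ c) A /\ monochromatic_between e c A B].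
Proof.
(* The size [k.+1] allows for the one vertex that two cliques of opposite colors may share. *)
have [k bip] := bipartite_ramsey t; have [q ram] := ramsey k.+1 (maxn k.+1 t).
have [n1 kst] := dense_complete_bipartite q.
exists (n1 + q) => T e sym nT dense.
have monoS c (A B : {set T}) : A \subset B -> monochromatic e c B -> monochromatic e c A.
  by move=> sAB mB x y /(subsetP sAB) xB /(subsetP sAB) yB; apply: mB.
have [cliques|[c noclique]] :
    (forall c, exists A : {set T}, #|A| = k.+1 /\ monochromatic e c A) \/
    (exists c, forall A : {set T}, #|A| = k.+1 -> ~ monochromatic e c A).
  pose cl c := [exists A : {set T}, (#|A| == k.+1) &&
    [forall x in A, forall y in A, (x != y) ==> (e x y == c)]].
  have clP c : reflect (exists A : {set T}, #|A| = k.+1 /\ monochromatic e c A) (cl c).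
    apply: (iffP existsP) => [[A /andP[/eqP kA /forall_inP mA]]|[A [kA mA]]].
      exists A; split=> // x y xA yA xy; apply/eqP.
      by move/(_ x xA)/forall_inP/(_ y yA)/implyP: mA; apply.
    exists A; rewrite kA eqxx; apply/forall_inP=> x xA; apply/forall_inP=> y yA.
    by apply/implyP=> xy; rewrite mA.
  case: (boolP [forall c, cl c]) => [/forallP all|].
    by left=> c; apply/clP.
  rewrite negb_forall => /existsP[c /clP noc]; right; exists c => A kA mA.
  by apply: noc; exists A.
- have [A [kA mA]] := cliques true; have [B [kB mB]] := cliques false.
  have AB : #|B :&: A| <= 1.
    rewrite leqNgt; apply/negP=> /card_gt1P[x [y [/setIP[xB xA] /setIP[yB yA] xy]]].
    by have := mA x y xA yA xy; rewrite mB.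
  have [||c [A' [B' [sA sB tA tB mAB]]]] := bip T e A (B :\: A).
  + by rewrite kA.
  + by have := cardsID A B; rewrite kB; lia.
  have {}mA := monoS _ _ _ sA mA.
  have {}mB := monoS _ _ _ (subset_trans sB (subsetDl B A)) mB.
  have dAB : [disjoint A' & B'].
    rewrite -setI_eq0 -subset0; apply/subsetP=> x /setIP[/(subsetP sA) xA].
    by move=> /(subsetP sB); rewrite inE xA.
  (* The clique whose color agrees with the connecting edges takes the role of [B]. *)
  case: c mAB => mAB.
  + exists false, B', A'; rewrite disjoint_sym; split=> //; left; split=> //.
    by move=> x y xB yA; rewrite sym; apply: mAB.
  + by exists true, A', B'; split=> //; left.
(* The condition [x != y] in the relation makes [S] and [U] disjoint. *)
- have [||S [U [qS qU SU]]] := kst T (fun x y => (x != y) && (e x y == c)).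
  + exact: leq_trans (leq_addr _ _) nT.
  + exact: dense.
  have sub (S' : {set T}) : q <= #|S'| ->
      exists2 A : {set T}, A \subset S' & #|A| = t /\ monochromatic e (~~ c) A.
    move=> /(ram T e c S' sym)[[A [_ kA mA]]|[A [sA kA mA]]].
      by have := noclique A kA mA.
    have [A' sA' tA'] : exists2 A' : {set T}, A' \subset A & #|A'| = t.
      by apply: exists_subset_card; rewrite kA leq_maxr.
    by exists A'; [apply: subset_trans sA | split=> //; apply: monoS mA].
  have [A sA [tA mA]] := sub S qS; have [B sB [tB mB]] := sub U qU.
  exists c, A, B; split=> //.
    rewrite -setI_eq0 -subset0; apply/subsetP=> x /setIP[/(subsetP sA) xS].
    by move=> /(subsetP sB) xU; have := SU x x xS xU; rewrite eqxx.
  right; split=> // x y /(subsetP sA) xS /(subsetP sB) yU.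
  by have /andP[_ /eqP] := SU x y xS yU.
Qed.

(** [A] and [B] are each in bijection with [S]. The two bijections are glued along [X], and
    disjointness keeps the result injective. *)
Lemma exists_embedding (S T : finType) (X : {set S}) (A B : {set T}) :
  [disjoint A & B] -> #|A| = #|S| -> #|B| = #|S| ->
  exists2 f : S -> T, injective f &
    forall x, f x \in (if x \in X then A else B).
Proof.
move=> dAB kA kB; pose h (C : {set T}) (kC : #|C| = #|S|) x :=
  enum_val (cast_ord (esym kC) (enum_rank x)).
have hC C kC x : h C kC x \in C by apply: enum_valP.
have hI C kC : injective (h C kC).
  by move=> x y /enum_val_inj/cast_ord_inj/enum_rank_inj.
have dis x y : h A kA x <> h B kB y.
  by move=> hxy; have := disjointFr dAB (hC A kA x); rewrite hxy hC.
exists (fun x => if x \in X then h A kA x else h B kB x); last first.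
  by move=> x; case: ifP.
move=> x y; case: ifP => xX; case: ifP => yX.
- exact: hI.
- by move/dis.
- by move/esym/dis.
- exact: hI.
Qed.

(** * Edge counts through containment in vertex sets *)

Lemma edgesP (G : sgraph) (a : {set G}) :
  reflect (exists u v, adj u v /\ a = [set u; v]) (a \in edges G).
Proof.
apply: (iffP imsetP) => [[[u v]]|[u [v [uv ->]]]].
  by rewrite inE /= => uv ->; exists u, v.
by exists (u, v); rewrite ?inE.
Qed.

Lemma edges_complete n : edges (complete n) = [set a : {set complete n} | #|a| == 2].
Proof.
apply/setP=> a; rewrite inE; apply/edgesP/cards2P.
  by case=> u [v [uv ->]]; exists u, v.
by case=> u [v [uv ->]]; exists u, v.
Qed.

Lemma num_edges_complete n : num_edges (complete n) = 'C(n, 2).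
Proof. by rewrite /num_edges edges_complete card_draws card_ord. Qed.

(** Containment of an edge in a vertex set is carried to preimages by [sub_imset_pre], hence this
    form here and in [num_edges_induced]. *)
Lemma num_cross_edges_setC (G : sgraph) (X : {set G}) :
  num_cross_edges X (~: X) =
  #|[set a in edges G | ~~ ((a \subset X) || (a \subset ~: X))]|.
Proof.
apply: eq_card => a; rewrite !inE; apply: andb_id2l => /edgesP[u [v [_ ->]]].
rewrite !subUset !sub1set !inE; apply/exists_inP/idP.
  move=> [x xX /exists_inP[y]]; rewrite inE => yX /eqP E.
  have := set21 x y; have := set22 x y; rewrite -E !inE => /pred2P yuv /pred2P xuv.
  by move: xX yX; case: xuv => ->; case: yuv => -> -> // /negPf->.
case: (boolP (u \in X)) => uX; case: (boolP (v \in X)) => vX // _.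
  by exists u => //; apply/exists_inP; exists v; rewrite ?inE.
by exists v => //; apply/exists_inP; exists u; rewrite ?inE // setUC.
Qed.

Lemma num_edges_induced (G : sgraph) (W : {set G}) :
  num_edges (induced W) = #|[set a in edges G | a \subset W]|.
Proof.
rewrite /num_edges -(card_imset _ (imset_inj val_inj)); apply: eq_card => a.
rewrite !inE; apply/imsetP/andP => [[b /edgesP[u [v [uv ->]]] ->]|].
  rewrite imsetU1 imset_set1; split; first by apply/edgesP; exists (val u), (val v).
  by rewrite subUset !sub1set; apply/andP; split; apply: valP.
case=> /edgesP[u [v [uv ->]]]; rewrite subUset !sub1set => /andP[uW vW].
exists [set exist _ u uW; exist _ v vW]; last by rewrite imsetU1 imset_set1.
by apply/edgesP; exists (exist _ u uW), (exist _ v vW).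
Qed.

(** * Colored copies as injective vertex maps *)

Section Copies.
Variables (n : nat) (G : sgraph).
Implicit Types (R B : {set {set complete n}}).

(** Counts on the side of [G]: for injective [f], this set has as many elements as the copy has
    edges in [R]. *)
Definition edges_into (f : G -> complete n) R :=
  [set a in edges G | f @: (a : {set G}) \in R].

Lemma imset_edge (f : G -> complete n) (a : {set G}) :
  injective f -> a \in edges G -> f @: a \in edges (complete n).
Proof.
move=> f_inj /edgesP[u [v [uv ->]]]; rewrite imsetU1 imset_set1.
apply/edgesP; exists (f u), (f v); split=> //=; rewrite /complete_adj.
by apply: contraTneq uv => /f_inj ->; rewrite adj_irr.
Qed.

Lemma card_edges_intoC f R B : two_coloring R B -> injective f ->
  #|edges_into f R| + #|edges_into f B| = num_edges G.
Proof.
move=> /andP[/eqP RB dRB] f_inj.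
rewrite /num_edges -(cardsID (edges_into f R) (edges G)); congr (_ + _).
  by apply: eq_card => a; rewrite !inE andbA andbb.
apply: eq_card => a; rewrite !inE; case: (boolP (a \in edges G)) => //= aG.
have := imset_edge f_inj aG; rewrite -RB inE.
by case: (boolP (_ \in R)) => //= aR _; rewrite (disjointFr dRB aR).
Qed.

(** The red and blue counts of a copy add up to [num_edges G], so the red count alone decides
    between the two admissible color patterns. *)
Lemma colored_copyP R B r : two_coloring R B -> r <= num_edges G ->
  reflect (exists2 f, injective f &
             #|edges_into f R| \in [:: r; num_edges G - r])
    (has_colored_copy G R B r (num_edges G - r)
     || has_colored_copy G R B (num_edges G - r) r).
Proof.
move=> RB r_le.
have cardI (f : G -> complete n) C : injective f ->
    #|[set f @: (a : {set G}) | a in edges G] :&: C| = #|edges_into f C|.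
  move=> f_inj; rewrite -(card_imset _ (imset_inj f_inj)); apply: eq_card => b.
  rewrite inE; apply/andP/imsetP => [[/imsetP[a aG ->] aC]|[a]].
    by exists a; rewrite // inE aG.
  by rewrite inE => /andP[aG aC] ->; split=> //; apply: imset_f.
have copyP k l : k + l = num_edges G ->
    reflect (exists2 f, injective f & #|edges_into f R| = k)
            (has_colored_copy G R B k l).
  move=> kl; apply: (iffP existsP).
    move=> [F /and3P[/existsP[f /andP[/injectiveP f_inj /eqP ->]] /eqP FR _]].
    by exists f => //; rewrite -cardI.
  move=> [f f_inj fR]; exists [set f @: (a : {set G}) | a in edges G].
  rewrite !cardI // fR eqxx /=; apply/andP; split; last first.
    by have := card_edges_intoC RB f_inj; rewrite fR -kl => /addnI ->.
  apply/existsP; exists (finfun f); apply/andP; split.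
    by apply/injectiveP=> x y; rewrite !ffunE; apply: f_inj.
  apply/eqP; apply: eq_imset => a; apply: eq_imset => x; by rewrite ffunE.
apply: (iffP orP) => [[]/copyP[|f f_inj fR]|[f f_inj]].
- by rewrite subnKC.
- by exists f; rewrite // fR inE eqxx.
- by rewrite subnK.
- by exists f; rewrite // fR !inE eqxx orbT.
rewrite !inE => /pred2P[] fR; [left|right]; apply/copyP; rewrite ?subnKC ?subnK //; by exists f.
Qed.

Lemma bal_ltP r k :
  reflect (exists2 s, s < k & forces_balance n G r s) (bal n G r < k).
Proof.
rewrite /bal; case: ex_minnP => m fm min_m; apply: (iffP idP) => [mk|].
  by exists m.
by move=> [s sk /min_m ms]; apply: leq_ltn_trans sk.
Qed.

End Copies.

(** * Cliques and cuts that halve the edges of K_n *)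

Lemma double_bin2 n : 2 * 'C(n, 2) = n * n.-1.
Proof. by rewrite -mul_bin_diag bin1. Qed.

(* [2 k (k - 1) = n (n - 1)] is a Pell equation; its solutions are
   generated from the trivial one by a linear recurrence. *)
Lemma exists_balanced_clique N :
  exists n k, [/\ N <= n, k <= n & 2 * 'C(k, 2) = 'C(n, 2)].
Proof.
suff [n [k [Nn kn E]]] :
    exists n k, [/\ N <= n, k <= n & 2 * (k.+1 * k) = n.+1 * n].
  exists n.+1, k.+1; split; [exact: leqW | by rewrite ltnS |].
  by apply/eqP; rewrite -(eqn_pmul2l (isT : 0 < 2)) !double_bin2 E.
elim: N => [|N [n [k [Nn kn E]]]]; first by exists 0, 0.
(* With x = 2n + 1 and y = 2k + 1 the equation reads x^2 - 2y^2 = -1; the step multiplies x + y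
   sqrt(2) by the unit 3 + 2 sqrt(2). *)
exists (4 * k + 3 * n + 3), (3 * k + 2 * n + 2).
by split; [lia | lia | nia].
Qed.

(* K_n with n = m ^ 2 and parts of sizes (m ^ 2 + m) / 2, (m ^ 2 - m) / 2: the
   two cliques on the parts have exactly half of the edges. *)
Lemma exists_balanced_cut N :
  exists n k, [/\ N <= n, k <= n & 2 * ('C(k, 2) + 'C(n - k, 2)) = 'C(n, 2)].
Proof.
(* The side of the square is [m.+1], and the parts are the consecutive triangular numbers [l] and
   [l + m.+1]. As [m.+1] is at least 2, [l] is positive and [l.-1] is not truncated. *)
pose m := N.+1; pose l := 'C(m.+1, 2).
have lm : 2 * l = m.+1 * m by rewrite double_bin2.
have lE : l + (l + m.+1) = m.+1 * m.+1 by nia.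
exists (m.+1 * m.+1), (l + m.+1); split; [by rewrite /m; nia | by lia |].
rewrite -lE addnK.
have := double_bin2 (l + m.+1); have := double_bin2 l; have := double_bin2 (l + (l + m.+1)).
have l_gt0 : 0 < l by rewrite bin_gt0.
case: l lm l_gt0 {lE} => // l lm _; rewrite !addSn !addnS /=; nia.
Qed.

(** * Necessity and sufficiency *)

Section Balanced.
Variables (G : sgraph) (r : nat).
Hypothesis r_le : r <= num_edges G.

(** Lets a count be replaced by that of the opposite color, or that of the edges inside the parts by
    that of the cut. *)
Lemma mem_subn x y : x + y = num_edges G ->
  (x \in [:: r; num_edges G - r]) = (y \in [:: r; num_edges G - r]).
Proof. by move=> xy; rewrite !inE; apply/pred2P/pred2P; move: r_le; lia. Qed.

(** Since [bal] is below half of the edges, a coloring with exactly half of them in each class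
    exceeds it in both colors. *)
Lemma tonal_balanced_copy : tonal r G ->
  exists N, forall n (R : {set {set complete n}}),
    N <= n -> R \subset edges (complete n) -> 2 * #|R| = 'C(n, 2) ->
    exists2 f : G -> complete n, injective f &
      #|edges_into f R| \in [:: r; num_edges G - r].
Proof.
case=> N tonalN; exists N => n R Nn RE cR.
have /bal_ltP[s sn /forallP/(_ R)/forallP/(_ (edges (complete n) :\: R))] := tonalN n Nn.
have RB : two_coloring R (edges (complete n) :\: R).
  rewrite /two_coloring; apply/andP; split.
    by rewrite -{1}(setIidPr RE) setID.
  by rewrite -setI_eq0 setIDA setDIl setDv set0I.
have cB : #|edges (complete n) :\: R| = #|R|.
  have := num_edges_complete n; rewrite /num_edges.
  by have := cardsID R (edges (complete n)); rewrite (setIidPr RE); lia.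
rewrite RB cB minnn /=.
have -> : s < #|R| by move: sn; rewrite -cR mul2n doubleK.
by move=> /(colored_copyP RB r_le).
Qed.

Lemma tonal_induced : tonal r G ->
  exists W : {set G}, num_edges (induced W) \in [:: r; num_edges G - r].
Proof.
move=> /tonal_balanced_copy[N copyN].
have [n [k [Nn kn E]]] := exists_balanced_clique N.
have [K _ kK] : exists2 K : {set complete n}, K \subset setT & #|K| = k.
  by apply: exists_subset_card; rewrite cardsT card_ord.
have [||f f_inj fR] := copyN n [set a : {set complete n} | a \subset K & #|a| == 2] Nn.
- by rewrite edges_complete; apply/subsetP=> a; rewrite !inE => /andP[].
- by rewrite cards_draws kK.
exists (f @^-1: K); rewrite num_edges_induced; apply: etrans fR; congr in_mem.
apply/esym/eq_card => a; rewrite !inE; apply: andb_id2l => aG.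
have := imset_edge f_inj aG; rewrite edges_complete inE => ->.
by rewrite andbT sub_imset_pre.
Qed.

Lemma tonal_cut : tonal r G ->
  exists X Y : {set G},
    [/\ X :|: Y = setT, [disjoint X & Y]
      & num_cross_edges X Y \in [:: r; num_edges G - r]].
Proof.
move=> /tonal_balanced_copy[N copyN].
have [n [k [Nn kn E]]] := exists_balanced_cut N.
have [K _ kK] : exists2 K : {set complete n}, K \subset setT & #|K| = k.
  by apply: exists_subset_card; rewrite cardsT card_ord.
pose D (C : {set complete n}) := [set a : {set complete n} | a \subset C & #|a| == 2].
have [||f f_inj fR] := copyN n (D K :|: D (~: K)) Nn.
- by rewrite edges_complete; apply/subsetP=> a; rewrite !inE -andb_orl => /andP[].
- rewrite cardsU !cards_draws [#|~: K|]cardsCs setCK kK card_ord.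
  suff -> : D K :&: D (~: K) = set0 by rewrite cards0 subn0.
  apply/setP=> a; rewrite !inE; apply/negP=> /andP[/andP[aK /cards2P[x [y [_ ax]]]]].
  move=> /andP[aKC _]; move: aK aKC; rewrite ax !subUset !sub1set inE.
  by move=> /andP[-> _].
exists (f @^-1: K), (~: (f @^-1: K)); split; first by rewrite setUCr.
  by rewrite -setI_eq0 setICr.
(* Red edges lie inside a part, so the cross edges of [G] are those sent to blue. *)
rewrite num_cross_edges_setC -(mem_subn (x := #|edges_into f (D K :|: D (~: K))|)) //.
rewrite /num_edges -(cardsID (edges_into f (D K :|: D (~: K))) (edges G)); congr (_ + _).
  by apply: eq_card => a; rewrite !inE; case: (a \in edges G).
apply: eq_card => a; rewrite !inE; case: (boolP (a \in edges G)) => //= aG.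
have := imset_edge f_inj aG; rewrite edges_complete inE => ->.
by rewrite !andbT !sub_imset_pre preimsetC.
Qed.

Lemma tonal_of_cut_induced (X W : {set G}) :
  num_cross_edges X (~: X) \in [:: r; num_edges G - r] ->
  num_edges (induced W) \in [:: r; num_edges G - r] ->
  tonal r G.
Proof.
move=> cutX indW; have [n0 pattern] := unavoidable_pattern #|G|.
(* From [n = 4] on, [n ^ 2] is at most 8 times the rounded-down half of ['C(n, 2)], and that half is
   positive. *)
exists (n0 + 4) => n n0n; have n4 : 4 <= n by lia.
have := double_bin2 n => bin2n.
(* For this [s], exceeding [s] means having at least half of the edges, rounded down. *)
apply/bal_ltP; exists ('C(n, 2)./2).-1; first by nia.
apply/forallP=> R; apply/forallP=> B; apply/implyP=> /andP[RB].
rewrite leq_min => /andP[halfR halfB]; apply/(colored_copyP RB r_le).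
pose C (c : bool) := if c then R else B.
have CE (c : bool) (a : {set complete n}) : a \in edges (complete n) ->
    (a \in C c) = ((a \in R) == c).
  have /andP[/eqP <- dRB] := RB; rewrite inE /C.
  case: c; first by case: (a \in R).
  by case: (boolP (a \in R)) => //= aR; rewrite (disjointFr dRB aR).
have C_edges c : C c \subset edges (complete n).
  have /andP[/eqP <- _] := RB; rewrite /C.
  by case: c; [apply: subsetUl | apply: subsetUr].
pose e (x y : complete n) := [set x; y] \in R.
have sym_e : symmetric e by move=> x y; rewrite /e setUC.
have dense c : #|complete n| ^ 2 <=
    8 * #|[set p : complete n * complete n | (p.1 != p.2) && (e p.1 p.2 == c)]|.
  set Q := [set _ | _]; have : #|C c| <= #|Q|.
    apply: leq_trans (leq_imset_card (fun p => [set p.1; p.2]) Q).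
    apply/subset_leq_card/subsetP=> a aC; have aE := subsetP (C_edges c) a aC.
    have /edgesP[x [y [xy axy]]] := aE; apply/imsetP; exists (x, y) => //.
    by rewrite inE (xy : x != y) /e -axy -CE.
  have : 'C(n, 2)./2 <= #|C c| by rewrite /C; case: (c); lia.
  by rewrite card_ord; nia.
have copyC c (f : G -> complete n) : injective f ->
    #|edges_into f (C c)| \in [:: r; num_edges G - r] ->
    exists2 f : G -> complete n, injective f &
      #|edges_into f R| \in [:: r; num_edges G - r].
  move=> f_inj; case: c => fC; exists f => //.
  by rewrite (mem_subn (y := #|edges_into f B|)) // card_edges_intoC.
have [|||c [A [A' [dA kA kA' mA' pat]]]] := pattern (complete n) e.
- exact: sym_e.
- by rewrite card_ord; lia.
- exact: dense.
(* Common to both patterns: [Z] goes to [A], the rest to [A'], and [P] describes the edges of [G]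
   that receive color [c]. *)
have embed (Z : {set G}) (P : pred {set G}) :
    #|[set a in edges G | P a]| \in [:: r; num_edges G - r] ->
    (forall (f : G -> complete n) u v, f u != f v ->
      f u \in (if u \in Z then A else A') -> f v \in (if v \in Z then A else A') ->
      (e (f u) (f v) == c) = P [set u; v]) ->
    exists2 f : G -> complete n, injective f &
      #|edges_into f R| \in [:: r; num_edges G - r].
  move=> cardP eP; have [f f_inj fZ] := exists_embedding Z dA kA kA'.
  apply: (copyC c f f_inj); apply: etrans cardP; congr in_mem; apply: eq_card => a.
  rewrite !inE; apply: andb_id2l => aG; rewrite CE ?imset_edge //.
  have /edgesP[u [v [uv ->]]] := aG; rewrite imsetU1 imset_set1 -(eP f) ?fZ //.
  by apply: contraTneq uv => /f_inj ->; rewrite adj_irr.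
case: pat => [[mA mAA']|[mA mAA']].
- rewrite num_edges_induced in indW; apply: (embed W _ indW) => f u v uv.
  rewrite subUset !sub1set; case: ifP => _ fu; case: ifP => _ fv.
  + by rewrite mA ?eqxx.
  + by rewrite mAA' //; case: (c).
  + by rewrite sym_e mAA' //; case: (c).
  + by rewrite mA' //; case: (c).
- rewrite num_cross_edges_setC in cutX; apply: (embed X _ cutX) => f u v uv.
  rewrite !subUset !sub1set !inE; case: ifP => _ fu; case: ifP => _ fv.
  + by rewrite mA //; case: (c).
  + by rewrite mAA' ?eqxx.
  + by rewrite sym_e mAA' ?eqxx.
  + by rewrite mA' //; case: (c).
Qed.

End Balanced.

Theorem theorem2p4 (G : sgraph) (r : nat)
    (r_gt0 : 0 < r) (r_le : r <= (num_edges G)./2) :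
  tonal r G <->
  (exists X Y : {set G},
     [/\ X :|: Y = setT, [disjoint X & Y]
       & num_cross_edges X Y \in [:: r; num_edges G - r]]) /\
  (exists W : {set G},
     num_edges (induced W) \in [:: r; num_edges G - r]).
Proof.
have {}r_le : r <= num_edges G by lia.
split=> [tonalG|[[X [Y [XY dXY cutX]]] [W indW]]].
  by split; [apply: tonal_cut | apply: tonal_induced].
have YE : Y = ~: X.
  apply/eqP; rewrite eqEsubset -disjoints_subset disjoint_sym dXY.
  by apply/subsetP=> x; have := in_setT x; rewrite -XY !inE; case: (x \in X).
by rewrite YE in cutX; apply: tonal_of_cut_induced cutX indW.
Qed.
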